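(* Let $\Gamma_1$ and $\Gamma_2$ be two finite simple graphs, and let $F_1,\ldots,F_n$ ($n\ge 1$) be a forest decomposition of $\Gamma_1$. For $i=1,\ldots,n$ let $F'_i:=\bigl(\Gamma_1-E(F_1)\cup\cdots\cup E(F_{i-1})\bigr)[V(F_i)]$. If $\sum_{i=1}^n\Delta(F'_i)\leq|V(\Gamma_2)|$, then \[\mathrm{pmd}(\Gamma_1\square\Gamma_2)\leq\mathrm{pmd}(\Gamma_2)+n\cdot\max\left\{\sum_{i=1}^n\Delta(F'_i),\ \chi(\Gamma_2)\right\}.\]
   Context: All graphs are finite and simple. A set $M\subseteq E$ of edges of a graph $\Gamma=(V,E)$ is a matching if its edges are pairwise disjoint. A matching $M$ is positive (in $\Gamma$) if there is a weight function $w\colon V\to\mathbb{R}$ such that for every edge $uv\in E$: $w(u)+w(v)>0$ if and only if $uv\in M$. A positive matching decomposition (pmd) of $\Gamma$ with $p$ parts is an ordered partition $E_1,\ldots,E_p$ of $E$ such that $E_i$ is a positive matching of the graph $(V,E\setminus\bigcup_{j=1}^{i-1}E_j)$ for $i=1,\ldots,p$. $\mathrm{pmd}(\Gamma)$ denotes the smallest $p$ for which $\Gamma$ has a pmd with $p$ parts. The Cartesian product $\Gamma_1\square\Gamma_2$ has vertex set $V(\Gamma_1)\times V(\Gamma_2)$, with $(a_1,a_2)\sim(b_1,b_2)$ if either $a_1=b_1$ and $a_2\sim b_2$, or $a_1\sim b_1$ and $a_2=b_2$. $\chi$ is the chromatic number and $\Delta$ the maximum degree. For a set $E'$ of edges,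 $\Gamma-E'$ is the graph obtained from $\Gamma$ by deleting the edges in $E'$ (keeping all vertices), and $\Gamma[U]$ is the subgraph induced by the vertex set $U$. A forest decomposition of a graph $\Gamma$ is an ordered edge-partition of $\Gamma$ into forests $F_1,\ldots,F_n$ (subgraphs of $\Gamma$ whose edge sets partition $E(\Gamma)$) such that, for all $i=1,\ldots,n$, the subgraph of $\Gamma-E(F_1)\cup\cdots\cup E(F_{i-1})$ induced by $V(F_i)$ is a forest. *)

(* Defs.v *)
From HB Require Import structures.
From mathcomp Require Import all_boot all_order all_algebra.
From mathcomp Require Import boolp reals.
From mathcomp Require Import lra.

Set Implicit Arguments.
Unset Strict Implicit.
Unset Printing Implicit Defensive.

Import Order.TTheory GRing.Theory Num.Theory.

Record sgraph (T : finType) := SGraph {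
  adj :> rel T;
  adj_sym : symmetric adj;
  adj_irr : irreflexive adj
}.

Section Graphs.

Variable T : finType.
Implicit Types (G : sgraph T) (U : {set T}) (D M : {set {set T}}).

Definition edges G : {set {set T}} :=
  [set e | [exists x, exists y, G x y && (e == [set x; y])]].

Lemma mem_edges G x y : ([set x; y] \in edges G) = G x y.
Proof.
rewrite inE; apply/existsP/idP => [[a /existsP[b /andP[Gab /eqP/setP eq_xy]]]|].
  have neq_ab : a != b by apply: contraTneq Gab => ->; rewrite adj_irr.
  have := eq_xy a; have := eq_xy b; have := eq_xy x; have := eq_xy y.
  rewrite !inE !eqxx ?orbT /= => /esym/orP[]/eqP-> /esym/orP[]/eqP-> //=.
  - by rewrite orbb eq_sym (negbTE neq_ab).
  - by rewrite adj_sym.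
  - by rewrite orbb (negbTE neq_ab).
by move=> Gxy; exists x; apply/existsP; exists y; rewrite Gxy /=.
Qed.

Definition max_degree G : nat := \max_(x : T) #|[set y | G x y]|.

Definition colorable G (k : nat) : bool :=
  [exists f : {ffun T -> 'I_k}, forall x, forall y, G x y ==> (f x != f y)].

Lemma colorable_exists G : exists k, colorable G k.
Proof.
exists #|T|; apply/existsP; exists [ffun x => enum_rank x].
apply/forallP => x; apply/forallP => y; apply/implyP => Gxy; rewrite !ffunE.
by apply: contraTneq Gxy => /enum_rank_inj ->; rewrite adj_irr.
Qed.

Definition chromatic_number G : nat := ex_minn (colorable_exists G).

(* A [ucycle] of size 2 only traverses a single edge back and forth. *)
Definition is_forest G : Prop :=
  forall c : seq T, ucycle G c -> size c <= 2.

Definition delete_edges_adj G D : rel T :=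
  fun x y => G x y && ([set x; y] \notin D).

Lemma delete_edges_sym G D : symmetric (delete_edges_adj G D).
Proof. by move=> x y; rewrite /delete_edges_adj adj_sym setUC. Qed.

Lemma delete_edges_irr G D : irreflexive (delete_edges_adj G D).
Proof. by move=> x; rewrite /delete_edges_adj adj_irr. Qed.

Definition delete_edges G D : sgraph T :=
  SGraph (@delete_edges_sym G D) (@delete_edges_irr G D).

Definition induced_adj G U : rel {x : T | x \in U} :=
  fun x y => G (val x) (val y).

Lemma induced_sym G U : symmetric (@induced_adj G U).
Proof. by move=> x y; apply: adj_sym. Qed.

Lemma induced_irr G U : irreflexive (@induced_adj G U).
Proof. by move=> x; apply: adj_irr. Qed.

Definition induced G U : sgraph {x : T | x \in U} :=
  SGraph (@induced_sym G U) (@induced_irr G U).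

(* Blocks may be empty. This does not affect the minimum defining [pmd],
   since empty blocks can be dropped. *)
Definition ordered_partition (S : finType) (A : {set S}) (p : nat)
    (E : 'I_p -> {set S}) : Prop :=
  (forall i j, i != j -> [disjoint E i & E j]) /\ \bigcup_i E i = A.

Definition matching G M : Prop := M \subset edges G /\ trivIset M.

Definition positive_matching (R : realType) G M : Prop :=
  matching G M /\
  exists w : T -> R, forall x y : T, G x y ->
    ((0 < w x + w y)%R <-> [set x; y] \in M).

Definition is_pmd (R : realType) G (p : nat) (E : 'I_p -> {set {set T}})
    : Prop :=
  ordered_partition (edges G) E /\
  forall i : 'I_p, positive_matching R
              (delete_edges G (\bigcup_(j < p | j < i) E j)) (E i).

Definition has_pmd (R : realType) G (p : nat) : Prop :=
  exists E : 'I_p -> {set {set T}}, is_pmd R G E.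

Lemma has_pmd_exists (R : realType) G : exists p, `[< has_pmd R G p >].
Proof.
exists #|edges G|; apply/asboolP; exists (fun i => [set enum_val i]).
split; first split.
- by move=> i j neq_ij; rewrite disjoints1 inE (inj_eq enum_val_inj).
- apply/setP => e; apply/bigcupP/idP => [[i _]|He].
    by rewrite inE => /eqP->; apply: enum_valP.
  by exists (enum_rank_in He e); rewrite // inE enum_rankK_in.
move=> i; have := enum_valP i.
rewrite inE => /existsP[a /existsP[b /andP[Gab /eqP def_e]]]; rewrite def_e.
split; first split.
- rewrite sub1set mem_edges /= /delete_edges_adj Gab /= -def_e.
  apply/bigcupP => -[j lt_ji]; rewrite inE => /eqP/enum_val_inj eq_ij.
  by rewrite eq_ij ltnn in lt_ji.
- by apply/trivIsetP => A B; rewrite !inE => /eqP-> /eqP->; rewrite eqxx.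
exists (fun z => if z \in [set a; b] then 1%R else (-2)%R) => x y.
rewrite /= /delete_edges_adj => /andP[Gxy _].
have neq_xy : x != y by apply: contraTneq Gxy => ->; rewrite adj_irr.
have neq_ab : a != b by apply: contraTneq Gab => ->; rewrite adj_irr.
rewrite in_set1; split=> [|/eqP <-]; last by rewrite !inE !eqxx orbT /=; lra.
case: ifPn => Hx; case: ifPn => Hy; try lra.
move=> _; rewrite eqEcard !cards2 neq_xy neq_ab andbT.
by apply/subsetP => z; rewrite in_set2 => /orP[]/eqP->.
Qed.

Definition pmd (R : realType) G : nat := ex_minn (has_pmd_exists R G).

(* The vertex set may contain vertices isolated in the subgraph. *)
Record subgraph G := Subgraph {
  sg_verts : {set T};
  sg_edges : {set {set T}};
  sg_edges_sub : sg_edges \subset edges G;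
  sg_edges_verts : forall e, e \in sg_edges -> e \subset sg_verts
}.

Section SubgraphGraph.

Variables (G : sgraph T) (F : subgraph G).

Definition subgraph_adj : rel {x : T | x \in sg_verts F} :=
  fun x y => [set val x; val y] \in sg_edges F.

Lemma subgraph_sym : symmetric subgraph_adj.
Proof. by move=> x y; rewrite /subgraph_adj setUC. Qed.

Lemma subgraph_irr : irreflexive subgraph_adj.
Proof.
move=> x; apply: contraFF (adj_irr G (val x)).
by rewrite -mem_edges; apply: (subsetP (sg_edges_sub F)).
Qed.

Definition subgraph_graph : sgraph {x : T | x \in sg_verts F} :=
  SGraph subgraph_sym subgraph_irr.

End SubgraphGraph.

End Graphs.

Section ForestDecomposition.

Variables (T : finType) (G : sgraph T) (n : nat) (F : 'I_n -> subgraph G).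

Definition residual (i : 'I_n) : sgraph T :=
  delete_edges G (\bigcup_(j < n | j < i) sg_edges (F j)).

Definition residual_induced (i : 'I_n)
    : sgraph {x : T | x \in sg_verts (F i)} :=
  induced (residual i) (sg_verts (F i)).

Definition forest_decomposition : Prop :=
  [/\ forall i, is_forest (subgraph_graph (F i)),
      ordered_partition (edges G) (fun i => sg_edges (F i))
    & forall i, is_forest (residual_induced i)].

End ForestDecomposition.

Section CartesianProduct.

Variables (T1 T2 : finType) (G1 : sgraph T1) (G2 : sgraph T2).

Definition cartesian_adj : rel (T1 * T2) := fun a b =>
  ((a.1 == b.1) && G2 a.2 b.2) || (G1 a.1 b.1 && (a.2 == b.2)).

Lemma cartesian_sym : symmetric cartesian_adj.
Proof.
by move=> a b; rewrite /cartesian_adj adj_sym (adj_sym G1) !(eq_sym a.1) !(eq_sym a.2).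
Qed.

Lemma cartesian_irr : irreflexive cartesian_adj.
Proof. by move=> a; rewrite /cartesian_adj !adj_irr andbF. Qed.

Definition cartesian : sgraph (T1 * T2)%type :=
  SGraph cartesian_sym cartesian_irr.

End CartesianProduct.

(* Main.v *)
(** A forest has a vertex ranking in which every vertex has at most one
neighbour of smaller rank (its parent), and a proper edge colouring with
[max_degree] colours. Let [k] bound both the chromatic number of [G2] and the
degrees of the forests, and let [c] be a proper [k]-colouring of [G2]. The edges
of [F i] are removed from all the copies of [G1] in [k] steps: at step [t], in
the copy of [G1] over [v], one removes the edges of [F i] whose colour [s]
satisfies [s + c v = t] modulo [k]. This matching is positive: a vertex [x]
matched to its parent gets weight [r x + 1], where [r] is the ranking, a vertex
[x] matched to a child gets [- (r x + 1)], and all others get a very negative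
weight. For adjacent [u] and [v] in [G2], the copies of [x] over [u] and [v] are
never both matched to the parent of [x], since [c] is proper. Once all the
forests are gone, disjoint copies of [G2] remain. *)

Require Import Defs.
From HB Require Import structures.
From mathcomp Require Import all_boot all_order all_algebra.
From mathcomp Require Import boolp reals.
From mathcomp Require Import zify lra.

Set Implicit Arguments.
Unset Strict Implicit.
Unset Printing Implicit Defensive.

Import Order.TTheory GRing.Theory Num.Theory.

(** * Positive matching decompositions as level functions on edges *)

Lemma eq_set2 (T : finType) (a b x y : T) :
  [set a; b] = [set x; y] -> (a = x /\ b = y) \/ (a = y /\ b = x).
Proof.
move=> /setP eq_ab.
have := eq_ab a; have := eq_ab b; have := eq_ab x; have := eq_ab y.
rewrite !inE !eqxx ?orbT /= => y_ab x_ab /esym/orP[]/eqP b_xy /esym/orP[]/eqP a_xy.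
- by left; split=> //; move: y_ab; rewrite a_xy b_xy orbb => /eqP.
- by right.
- by left.
- by right; split=> //; move: x_ab; rewrite a_xy b_xy orbb => /eqP.
Qed.

(** Turns a family of blocks into one numeric function, so that being removed earlier becomes an
    inequality. *)
Lemma ordered_partition_index (S : finType) (A : {set S}) p
    (E : 'I_p -> {set S}) :
  ordered_partition A E ->
  exists f : S -> nat, (forall e, e \in A -> f e < p) /\
    forall (i : 'I_p) e, e \in A -> (e \in E i) = (f e == i).
Proof.
case=> disjE covE.
(* The default [p] is taken only outside [A], where nothing is claimed. *)
exists (fun e => if [pick i | e \in E i] is Some i then i : nat else p).
split=> [e|i e]; rewrite -covE => /bigcupP[j _ ej]; case: pickP => [l el|/(_ j)].
- by [].
- by rewrite ej.
- have [eq_li | neq_li] := eqVneq l i; first by rewrite -eq_li el eqxx.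
  rewrite (disjointFr (disjE _ _ neq_li) el).
  by apply/esym/negbTE; rewrite (inj_eq val_inj).
- by rewrite ej.
Qed.

(* A pmd encoded by the function sending an edge to the index of its part. *)
Definition pmd_levels (R : realType) (T : finType) (G : sgraph T) (p : nat)
    (l : T -> T -> nat) : Prop :=
  [/\ forall x y, G x y -> l x y = l y x,
      forall x y, G x y -> l x y < p,
      forall x y z, G x y -> G x z -> l x y = l x z -> y = z
    & forall i, i < p -> exists w : T -> R, forall x y, G x y -> i <= l x y ->
        ((0 < w x + w y)%R <-> l x y = i)].

Lemma has_pmd_levels (R : realType) (T : finType) (G : sgraph T) p :
  has_pmd R G p -> exists l, pmd_levels R G p l.
Proof.
case=> E [partE posE].
have [f [f_lt fE]] := ordered_partition_index partE.
have in_res (i : 'I_p) x y : G x y -> i <= f [set x; y] ->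
    delete_edges G (\bigcup_(j < p | j < i) E j) x y.
  move=> Gxy le_if; rewrite /= /delete_edges_adj Gxy /=.
  apply/bigcupP => -[j lt_ji]; rewrite fE ?mem_edges // => /eqP fj.
  by rewrite fj leqNgt lt_ji in le_if.
exists (fun x y => f [set x; y]); split.
- by move=> x y _; rewrite setUC.
- by move=> x y Gxy; apply: f_lt; rewrite mem_edges.
- move=> x y z Gxy Gxz eq_f.
  have fy : f [set x; y] < p by apply: f_lt; rewrite mem_edges.
  have [[_ /trivIsetP trivE] _] := posE (Ordinal fy).
  have Ey : [set x; y] \in E (Ordinal fy) by rewrite fE ?mem_edges /=.
  have Ez : [set x; z] \in E (Ordinal fy) by rewrite fE ?mem_edges //= eq_f.
  have [/eq_set2[[_ //]|[-> //]]|neq] := eqVneq [set x; y] [set x; z].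
  have /disjoint_setI0/setP/(_ x) := trivE _ _ Ey Ez neq.
  by rewrite !inE eqxx.
- move=> i lt_ip; have [_ [w wP]] := posE (Ordinal lt_ip).
  exists w => x y Gxy le_il; rewrite wP; last exact: in_res.
  by rewrite fE ?mem_edges //; split=> /eqP.
Qed.

Lemma pmd_levels_has_pmd (R : realType) (T : finType) (G : sgraph T) p l :
  pmd_levels R G p l -> has_pmd R G p.
Proof.
move=> [l_sym l_lt l_match l_pos].
pose E (i : 'I_p) : {set {set T}} :=
  [set e | [exists x, exists y, [&& G x y, e == [set x; y] & l x y == i]]].
have E_ex i e : e \in E i -> exists x y, [/\ G x y, e = [set x; y] & l x y = i].
  rewrite inE => /existsP[x /existsP[y /and3P[Gxy /eqP-> /eqP lxy]]].
  by exists x, y.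
have EP i x y : G x y -> ([set x; y] \in E i) = (l x y == i).
  move=> Gxy; apply/idP/eqP => [/E_ex[a [b [Gab eq_ab <-]]]|lxy].
    by case: (eq_set2 eq_ab) => -[-> ->] //; rewrite -l_sym.
  by rewrite inE; apply/existsP; exists x; apply/existsP; exists y;
     rewrite Gxy eqxx lxy eqxx.
exists E; split; first split.
- move=> i j neq_ij; rewrite -setI_eq0 -subset0; apply/subsetP => e.
  rewrite inE => /andP[/E_ex[x [y [Gxy -> lxy]]]].
  by rewrite EP // lxy (inj_eq val_inj) (negbTE neq_ij).
- apply/setP => e; apply/bigcupP/idP => [[i _ /E_ex[x [y [Gxy -> _]]]]|].
    by rewrite mem_edges.
  rewrite inE => /existsP[x /existsP[y /andP[Gxy /eqP->]]].
  by exists (Ordinal (l_lt _ _ Gxy)); rewrite // EP.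
move=> i; split; first split.
- apply/subsetP => e /E_ex[x [y [Gxy -> lxy]]].
  rewrite mem_edges /= /delete_edges_adj Gxy /=.
  by apply/bigcupP => -[j lt_ji]; rewrite EP // lxy => /eqP eq_ij;
     rewrite eq_ij ltnn in lt_ji.
- apply/trivIsetP => A B /E_ex[x [y [Gxy -> lxy]]] /E_ex[a [b [Gab -> lab]]].
  (* [l_match] compares edges with a common first endpoint; the symmetry of [l] brings any two
     meeting edges into this position, in four cases. *)
  have key u v u' v' : G u v -> G u' v' -> l u v = i -> l u' v' = i ->
      u = u' -> [set u; v] = [set u'; v'].
    move=> Guv Guv' luv luv' equ; rewrite -equ in Guv' luv' *.
    by rewrite (l_match _ _ _ Guv Guv') // luv.
  have Gyx : G y x by rewrite adj_sym.
  have Gba : G b a by rewrite adj_sym.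
  have lyx : l y x = i by rewrite -l_sym.
  have lba : l b a = i by rewrite -l_sym.
  apply: contraR => /pred0Pn[z /andP[]].
  rewrite !inE => /orP[]/eqP zx /orP[]/eqP za; apply/eqP.
  + by apply: key => //; rewrite -zx.
  + by rewrite [RHS]setUC; apply: key => //; rewrite -zx.
  + by rewrite setUC; apply: key => //; rewrite -zx.
  + by rewrite setUC [RHS]setUC; apply: key => //; rewrite -zx.
- have [w wP] := l_pos _ (ltn_ord i); exists w => x y.
  rewrite /= /delete_edges_adj => /andP[Gxy notE].
  rewrite EP // wP //; first by split=> [->|/eqP].
  rewrite leqNgt; apply: contra notE => lt_li.
  by apply/bigcupP; exists (Ordinal (l_lt _ _ Gxy)); rewrite // EP.
Qed.

(** * Rankings and edge colourings of forests *)

(* If every vertex of [S] had two neighbours in [S], every path in [S] could be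
   prolonged, as turning back onto itself would close a cycle. *)
Lemma forest_leaf (T : finType) (H : sgraph T) (S : {set T}) :
  is_forest H -> S != set0 ->
  exists2 y, y \in S & #|[set z in S | H y z]| <= 1.
Proof.
move=> forestH /set0Pn[x0 Sx0]; apply: contrapT => noleaf.
have deg2 y : y \in S -> 1 < #|[set z in S | H y z]|.
  by move=> Sy; rewrite ltnNge; apply/negP => le1; apply: noleaf; exists y.
(* The path is prolonged at its front, so only membership of its head in [S] has to be recorded. *)
have long m : exists x p, [/\ size p = m, path H x p, uniq (x :: p)
                            & x \in S].
  elim: m => [|m [x [p [szp Hp Up Sx]]]]; first by exists x0, [::].
  have [z Hxz [Sz nz]] : exists2 z, H x z & z \in S /\ z != head x p.
    case/card_gt1P: (deg2 x Sx) => a [b []].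
    rewrite !inE => /andP[Sa Ha] /andP[Sb Hb] neq_ab.
    have [eqa|] := eqVneq a (head x p); last by exists a.
    by exists b; rewrite // -eqa eq_sym.
  exists z, (x :: p); split => //=; first by rewrite szp.
    by rewrite adj_sym Hxz.
  rewrite -/(uniq (x :: p)) Up andbT inE negb_or.
  apply/andP; split; first by apply: contraTneq Hxz => ->; rewrite adj_irr.
  (* If [z] were on [p], the stretch from [x] to [z] would close up to a cycle. As [z] is not the
     first vertex of [p], [p1] is nonempty and this cycle is too long for a forest. *)
  apply/negP => pz; case/splitPr: p / pz Hp Up nz {szp} => p1 p2.
  rewrite cat_path /= => /and3P[Hp1 Hz _] Up nz.
  have /forestH : ucycle H (x :: rcons p1 z).
    rewrite /ucycle /= !rcons_path last_rcons Hp1 Hz /= adj_sym Hxz /=.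
    have : subseq (x :: rcons p1 z) (x :: p1 ++ z :: p2).
      by rewrite -cat_rcons /= eqxx prefix_subseq.
    by move/subseq_uniq/(_ Up).
  case: p1 nz {Hp1 Hz Up} => [|a p1] /=; first by rewrite eqxx.
  by rewrite size_rcons.
have [x [p [szp _ /card_uniqP Up _]]] := long #|T|.
by have := max_card (mem (x :: p)); rewrite Up /= szp ltnn.
Qed.

(** Induction on the vertex set by removing a leaf. Put back, the leaf gets the largest rank, so its
    only possible neighbour is its parent and it is nobody's parent; its edge gets a colour not yet
    used at that neighbour. *)
Lemma forest_rank_coloring (T : finType) (H : sgraph T) k :
  is_forest H -> max_degree H <= k ->
  exists (r : T -> nat) (col : T -> T -> nat),
  [/\ forall x y, H x y -> r x != r y,
      forall x y z, H x y -> H x z -> r y < r x -> r z < r x -> y = z,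
      forall x y, col x y = col y x,
      forall x y, H x y -> col x y < k
    & forall x y z, H x y -> H x z -> col x y = col x z -> y = z].
Proof.
move=> forestH degH.
(* The subgraph induced on [S] is kept as a relation on [T], so that the induction changes a set and
   not a type. *)
pose HS (S : {set T}) x y := [&& x \in S, y \in S & H x y].
suff [r [col [r1 r2 c1 c2 c3]]] : exists (r : T -> nat) (col : T -> T -> nat),
  [/\ forall x y, HS setT x y -> r x != r y,
      forall x y z, HS setT x y -> HS setT x z ->
        r y < r x -> r z < r x -> y = z,
      forall x y, col x y = col y x,
      forall x y, HS setT x y -> col x y < k
    & forall x y z, HS setT x y -> HS setT x z -> col x y = col x z -> y = z].
  exists r, col; split=> //.
  - by move=> x y Hxy; apply: r1; rewrite /HS !inE.
  - by move=> x y z Hxy Hxz; apply: r2; rewrite /HS !inE.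
  - by move=> x y Hxy; apply: c2; rewrite /HS !inE.
  - by move=> x y z Hxy Hxz; apply: c3; rewrite /HS !inE.
move: (setT : {set T}) => S; have [m] := ubnP #|S|; elim: m S => // m IHm S ltSm.
have [S0|/(forest_leaf forestH)[y Sy leafy]] := eqVneq S set0.
  exists (fun=> 0), (fun _ _ => 0).
  by rewrite /HS S0; split=> // x y; rewrite inE.
have [|r [col]] := IHm (S :\ y); first by move: ltSm; rewrite (cardsD1 y) Sy.
move=> [r1 r2 c1 c2 c3].
have leafP u v : HS S y u -> HS S y v -> u = v.
  move=> /and3P[_ Su Hu] /and3P[_ Sv Hv].
  by move/card_le1P: leafy => /(_ u); rewrite !inE Su Hu => /(_ isT v);
     rewrite !inE Sv Hv => /esym/eqP.
have HSC u v : HS S u v = HS S v u by rewrite /HS adj_sym andbCA.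
have HSirr u : HS S u u = false by rewrite /HS adj_irr !andbF.
have HS'E u v : u != y -> v != y -> HS S u v -> HS (S :\ y) u v.
  by move=> uy vy /and3P[Su Sv Huv]; rewrite /HS !inE uy vy Su Sv.
(* The colour of the edge at the leaf. Quantifying over the at most one neighbour covers an isolated
   [y], even for [k = 0]. *)
have [a aP] : exists a, forall x, HS S y x ->
    a < k /\ forall z, HS (S :\ y) x z -> col x z != a.
  have [/existsP[x Hyx]|none] := boolP [exists x, HS S y x]; last first.
    exists 0 => x Hx; case/existsP: none; by exists x.
  pose A := [set z | HS (S :\ y) x z].
  (* In [S :\ y] the vertex [x] has lost its neighbour [y], so fewer than [k] colours occur at
     it. *)
  have ltA : #|A| < k.
    apply: leq_trans degH; apply: leq_trans (leq_bigmax x).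
    apply: proper_card; apply/properP; split.
      by apply/subsetP => z; rewrite !inE => /and3P[].
    exists y; last by rewrite inE /HS !inE eqxx /= andbF.
    by rewrite inE; move: Hyx; rewrite HSC => /and3P[].
  have /hasP[a] : has (fun a => a \notin [seq col x z | z in A]) (iota 0 k).
    apply: contraLR ltA => /hasPn allL; rewrite -leqNgt.
    rewrite -(size_image (col x) A) -{1}(size_iota 0 k).
    by apply: uniq_leq_size (iota_uniq _ _) _ => b /allL /negPn.
  rewrite mem_iota /= => ltak aL.
  exists a => x' /(leafP _ _ Hyx) <-; split=> // z Hxz.
  by apply: contra aL => /eqP <-; apply: image_f; rewrite inE.
pose M := \max_z r z.
have r_le z : r z <= M by apply: leq_bigmax.
exists (fun x => if x == y then M.+1 else r x).
exists (fun u v => if (u == y) || (v == y) then a else col u v); split.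
- move=> u v; have [->|uy] := eqVneq u y; have [->|vy] := eqVneq v y.
  + by rewrite HSirr.
  + by rewrite gtn_eqF // ltnS.
  + by rewrite ltn_eqF // ltnS.
  + by move=> /(HS'E _ _ uy vy); apply: r1.
- move=> u v z; have [->|uy] := eqVneq u y; first by move=> /leafP Hv /Hv.
  have gtM b : (M.+1 < r b) = false by apply/negbTE; rewrite -leqNgt leqW.
  have [->|vy] := eqVneq v y; first by rewrite gtM.
  have [->|zy] := eqVneq z y; first by rewrite gtM.
  by move=> /(HS'E _ _ uy vy) Huv /(HS'E _ _ uy zy); apply: r2.
- by move=> u v; rewrite orbC c1.
- move=> u v Huv; have [eq_uy|uy] := eqVneq u y.
    by rewrite eq_uy in Huv; have [] := aP _ Huv.
  have [eq_vy|vy] /= := eqVneq v y; last by apply/c2/HS'E.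
  by rewrite eq_vy HSC in Huv; have [] := aP _ Huv.
- move=> u v z Huv Huz; have [eq_uy|uy] /= := eqVneq u y.
    by move=> _; apply: leafP; rewrite -eq_uy.
  have [eq_vy|vy] := eqVneq v y; have [eq_zy|zy] := eqVneq z y.
  + by rewrite eq_vy eq_zy.
  + move=> eqa; rewrite eq_vy HSC in Huv; have [_] := aP _ Huv.
    by move=> /(_ z (HS'E _ _ uy zy Huz)); rewrite eqa eqxx.
  + move=> eqa; rewrite eq_zy HSC in Huz; have [_] := aP _ Huz.
    by move=> /(_ v (HS'E _ _ uy vy Huv)); rewrite eqa eqxx.
  + by apply: c3; apply: HS'E.
Qed.

(** * Weights for one step of the removal of a forest *)

(* [H] is the graph of remaining edges of [G1], inducing a forest on [V], and [F]
   the relation of the edges to be removed. *)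
Lemma forest_step_weight (R : realType) (T1 T2 : finType) (G2 : sgraph T2)
    (V : {set T1}) (H F : rel T1) (r : T1 -> nat) (col : T1 -> T1 -> nat)
    (c : T2 -> nat) (k t : nat) :
  symmetric H -> symmetric F ->
  (forall x y, F x y -> [/\ H x y, x \in V & y \in V]) ->
  (forall x y, x \in V -> y \in V -> H x y -> r x != r y) ->
  (forall x y z, x \in V -> y \in V -> z \in V -> H x y -> H x z ->
     r y < r x -> r z < r x -> y = z) ->
  (forall x y, col x y = col y x) ->
  (forall x y, F x y -> col x y < k) ->
  (forall x y z, F x y -> F x z -> col x y = col x z -> y = z) ->
  (forall v, c v < k) -> (forall u v, G2 u v -> c u != c v) ->
  exists w : T1 * T2 -> R,
    (forall x y v, H x y -> (0 < w (x, v) + w (y, v))%R <->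
       F x y /\ (col x y + c v) %% k = t) /\
    (forall x u v, G2 u v -> (w (x, u) + w (x, v) <= 0)%R).
Proof.
move=> H_sym F_sym FP r_neq r_par col_sym col_lt col_inj c_lt c_neq.
have modkI a b d : a < k -> b < k -> (a + d) %% k = (b + d) %% k -> a = b.
  by move=> ak bk /eqP; rewrite eqn_modDr !modn_small // => /eqP.
pose m x y v := F x y && ((col x y + c v) %% k == t).
have m_sym x y v : m x y v = m y x v by rewrite /m F_sym col_sym.
have m_inj x y z v : m x y v -> m x z v -> y = z.
  move=> /andP[Fy /eqP ty] /andP[Fz /eqP tz]; apply: (col_inj x) => //.
  by apply: (@modkI _ _ (c v)); rewrite ?col_lt ?ty ?tz.
pose up x v := [exists y, m x y v && (r y < r x)].
pose dn x v := [exists y, m x y v && (r x < r y)].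
pose N := \max_z r z.
have r_le z : r z <= N by apply: leq_bigmax.
(* The default [- N.+1] offsets the largest possible positive weight, so one unmatched endpoint
   already makes a sum nonpositive. *)
pose w (a : T1 * T2) : R :=
  (if up a.1 a.2 then (r a.1).+1%:R
   else if dn a.1 a.2 then - (r a.1).+1%:R else - N.+1%:R)%R.
have leN z : ((r z).+1%:R <= N.+1%:R :> R)%R by rewrite ler_nat ltnS.
have ge0 b : (0 <= b%:R :> R)%R by [].
have w_le x v : (w (x, v) <= (r x).+1%:R)%R.
  rewrite /w /=; have := leN x; have := ge0 (r x).+1; have := ge0 N.+1.
  by case: ifP => // _; case: ifP => _; lra.
have w_notup x v : ~~ up x v -> (w (x, v) <= - (r x).+1%:R)%R.
  move=> /negbTE nup; rewrite /w /= nup; have := leN x.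
  by case: ifP => _; lra.
have w_notin x v : x \notin V -> (w (x, v) <= - N.+1%:R)%R.
  move=> xV; have no (P : pred T1) : [exists y, m x y v && P y] = false.
    apply/existsP => -[y /andP[/andP[/FP[_ Vx _] _] _]].
    by rewrite Vx in xV.
  by rewrite /w /up /dn !no.
exists w; split=> [x y v Hxy|x u v Guv].
  suff : if m x y v then (0 < w (x, v) + w (y, v))%R
         else (w (x, v) + w (y, v) <= 0)%R.
    case: ifPn => [/andP[Fxy /eqP tt]|nm] wP; first by split.
    split=> [|[Fxy tt]]; first by move=> ?; exfalso; lra.
    by rewrite /m Fxy tt eqxx in nm.
  have notV z z' : z \notin V -> m z z' v = false.
    by move=> zV; apply/negbTE; apply: contra zV => /andP[/FP[]].
  have [Vx|xV] := boolP (x \in V); last first.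
    rewrite notV //.
    by have := w_notin x v xV; have := w_le y v; have := leN y; lra.
  have [Vy|yV] := boolP (y \in V); last first.
    rewrite m_sym notV //.
    by have := w_notin y v yV; have := w_le x v; have := leN x; lra.
  (* By symmetry [x] is the lower endpoint, hence the parent of [y]. *)
  wlog lt_xy : x y Hxy Vx Vy / r x < r y.
    move=> wlt; have := r_neq _ _ Vx Vy Hxy.
    rewrite neq_ltn => /orP[] lt_r; first exact: wlt.
    by rewrite m_sym addrC; apply: wlt; rewrite // H_sym.
  (* Matched case: [y] is the only partner of [x], so [x] is not [up], and the sum is
     [r y - r x]. *)
  case: ifPn => [mxy|nmxy].
    have up_y : up y v by apply/existsP; exists x; rewrite m_sym mxy.
    have dn_x : dn x v by apply/existsP; exists y; rewrite mxy.
    have nup_x : up x v = false.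
      apply/existsP => -[z /andP[mxz]].
      by rewrite -(m_inj _ _ _ _ mxy mxz) ltnNge ltnW.
    by rewrite /w /= up_y nup_x dn_x addrC subr_gt0 ltr_nat ltnS.
  (* Unmatched case: a lower partner of [y] would be its only parent [x], so [y] is not [up], and
     [- (r y + 1)] outweighs [r x + 1]. *)
  have /w_notup : ~~ up y v.
    apply/existsP => -[z /andP[myz lt_zy]].
    have [Fyz _] := andP myz; have [Hyz _ Vz] := FP _ _ Fyz.
    have Hyx : H y x by rewrite H_sym.
    have eq_xz := r_par _ _ _ Vy Vx Vz Hyx Hyz lt_xy lt_zy.
    by rewrite m_sym eq_xz myz in nmxy.
  have : ((r x).+1%:R <= (r y).+1%:R :> R)%R by rewrite ler_nat ltnS ltnW.
  by have := w_le x v; lra.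
(* If one copy of [x] is not [up], its weight offsets that of the other. If both are, they are
   matched to the same parent along edges of one colour, which forces [c u = c v]. *)
have [up_u|/w_notup] := boolP (up x u); last by have := w_le x v; lra.
have [up_v|/w_notup] := boolP (up x v); last by have := w_le x u; lra.
have /existsP[y /andP[/andP[Fy ty] lt_y]] := up_u.
have /existsP[z /andP[/andP[Fz tz] lt_z]] := up_v.
have [Hy Vx Vy] := FP _ _ Fy; have [Hz _ Vz] := FP _ _ Fz.
have eq_yz := r_par _ _ _ Vx Vy Vz Hy Hz lt_y lt_z.
have /eqP := c_neq _ _ Guv; case; apply: (@modkI _ _ (col x y)) => //.
by rewrite !(addnC (c _)) (eqP ty) eq_yz (eqP tz).
Qed.

(** * Levels [i * k + t], for step [t] of forest [i], as two-digit numbers in base [k] *)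

Lemma mulD_ltn_le k a b s t : s < k -> t < k -> a * k + s <= b * k + t -> a <= b.
Proof. nia. Qed.

Lemma mulD_ltn_inj k a b s t :
  s < k -> t < k -> a * k + s = b * k + t -> a = b /\ s = t.
Proof.
move=> ltsk lttk eq_st; suff eq_ab : a = b.
  by rewrite eq_ab in eq_st *; move/addnI: eq_st.
by apply/eqP; rewrite eqn_leq; apply/andP; split;
   [apply: (mulD_ltn_le ltsk lttk) | apply: (mulD_ltn_le lttk ltsk)]; rewrite eq_st.
Qed.

(** The induced forest lives on a subtype; its ranking and colouring are extended by 0 to all of
    [T], since the weights are functions on all vertices. They form a pair so that a single choice
    over all [i] provides both. *)
Lemma forest_decomposition_rank_coloring (T : finType) (G : sgraph T) n
    (F : 'I_n -> subgraph G) (i : 'I_n) k :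
  forest_decomposition F -> max_degree (residual_induced F i) <= k ->
  exists rc : (T -> nat) * (T -> T -> nat),
  let V := sg_verts (F i) in let H := residual F i in
  [/\ forall x y, x \in V -> y \in V -> H x y -> rc.1 x != rc.1 y,
      forall x y z, x \in V -> y \in V -> z \in V -> H x y -> H x z ->
        rc.1 y < rc.1 x -> rc.1 z < rc.1 x -> y = z,
      forall x y, rc.2 x y = rc.2 y x,
      forall x y, x \in V -> y \in V -> H x y -> rc.2 x y < k
    & forall x y z, x \in V -> y \in V -> z \in V -> H x y -> H x z ->
        rc.2 x y = rc.2 x z -> y = z].
Proof.
case=> _ _ /(_ i) forestF degF.
have [r [col [r1 r2 c1 c2 c3]]] := forest_rank_coloring forestF degF.
pose V := sg_verts (F i).
pose ins (x : T) : option {x : T | x \in V} := insub x.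
pose r' x := oapp r 0 (ins x).
pose col' x y := if ins x is Some u then oapp (col u) 0 (ins y) else 0.
exists (r', col') => /=.
have insE x (Vx : x \in V) : ins x = Some (Sub x Vx) by apply: insubT.
split.
- move=> x y Vx Vy Hxy; rewrite /r' (insE _ Vx) (insE _ Vy) /=.
  exact: r1.
- move=> x y z Vx Vy Vz Hxy Hxz.
  rewrite /r' (insE _ Vx) (insE _ Vy) (insE _ Vz) /= => lty ltz.
  exact: (congr1 val (r2 (Sub x Vx) (Sub y Vy) (Sub z Vz) Hxy Hxz lty ltz)).
- move=> x y; rewrite /col'.
  by case: (ins x) (ins y) => [u|] [v|] //=.
- move=> x y Vx Vy Hxy; rewrite /col' (insE _ Vx) (insE _ Vy) /=.
  exact: c2.
- move=> x y z Vx Vy Vz Hxy Hxz.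
  rewrite /col' (insE _ Vx) (insE _ Vy) (insE _ Vz) /= => eqc.
  exact: (congr1 val (c3 (Sub x Vx) (Sub y Vy) (Sub z Vz) Hxy Hxz eqc)).
Qed.

(** * The bound for the Cartesian product *)

Lemma chromatic_coloring (T : finType) (G : sgraph T) k :
  chromatic_number G <= k ->
  exists c : T -> nat, (forall v, c v < k) /\ forall u v, G u v -> c u != c v.
Proof.
rewrite /chromatic_number; case: ex_minnP => m /existsP[f fP] _ le_mk.
exists (fun v => nat_of_ord (f v)); split=> [v|u v Guv].
  exact: leq_trans (ltn_ord _) le_mk.
by move/forallP: fP => /(_ u)/forallP/(_ v); rewrite Guv.
Qed.

Lemma pmdP (R : realType) (T : finType) (G : sgraph T) : has_pmd R G (pmd R G).
Proof. by rewrite /pmd; case: ex_minnP => p /asboolP. Qed.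

Lemma pmd_le (R : realType) (T : finType) (G : sgraph T) p :
  has_pmd R G p -> pmd R G <= p.
Proof. by move=> Gp; rewrite /pmd; case: ex_minnP => q _; apply; apply/asboolP. Qed.

(** A common bound [k] gives every forest its own window of [k] levels; the copies of [G2] come
    afterwards, at the levels from [n * k] on. *)
Lemma pmd_cartesian_le (R : realType) (T1 T2 : finType)
    (G1 : sgraph T1) (G2 : sgraph T2) (n k : nat) (F : 'I_n -> subgraph G1) :
  forest_decomposition F ->
  (forall i, max_degree (residual_induced F i) <= k) ->
  chromatic_number G2 <= k ->
  pmd R (cartesian G1 G2) <= pmd R G2 + n * k.
Proof.
move=> F_dec degF /chromatic_coloring[c [c_lt c_neq]].
have [l2 [l2_sym l2_lt l2_inj l2_pos]] := has_pmd_levels (pmdP R G2).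
have /fin_all_exists[rc rcP] :=
  fun i => forest_decomposition_rank_coloring F_dec (degF i).
have [_ partF _] := F_dec.
have [f [f_lt fE]] := ordered_partition_index partF.
have f_ltG x y : G1 x y -> f [set x; y] < n.
  by move=> Gxy; apply: f_lt; rewrite mem_edges.
have residualP (i : 'I_n) x y : G1 x y -> i <= f [set x; y] -> residual F i x y.
  move=> Gxy le_if; rewrite /= /delete_edges_adj Gxy /=.
  apply/bigcupP => -[j lt_ji]; rewrite fE ?mem_edges // => /eqP fj.
  by rewrite fj leqNgt lt_ji in le_if.
have vertsP (i : 'I_n) x y : G1 x y -> f [set x; y] = i ->
    x \in sg_verts (F i) /\ y \in sg_verts (F i).
  move=> Gxy fi; have : [set x; y] \in sg_edges (F i).
    by rewrite fE ?mem_edges // fi.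
  by move/sg_edges_verts; rewrite subUset !sub1set => /andP[].
(* Through [insub] the forest index can be the plain number given by [f]; the default 0 is never met
   on edges of [G1]. *)
pose cl (m : nat) (x y : T1) := if insub m is Some i then (rc i).2 x y else 0.
have clE (i : 'I_n) x y : cl i x y = (rc i).2 x y by rewrite /cl valK.
pose l (a b : T1 * T2) : nat :=
  if a.1 == b.1 then n * k + l2 a.2 b.2
  else f [set a.1; b.1] * k +
       (cl (f [set a.1; b.1]) a.1 b.1 + c a.2) %% k.
have l_v x u v : l (x, u) (x, v) = n * k + l2 u v by rewrite /l eqxx.
have l_h x y v : G1 x y -> l (x, v) (y, v) =
    f [set x; y] * k + (cl (f [set x; y]) x y + c v) %% k.
  by move=> Gxy; rewrite /l /=; case: eqP Gxy => // ->; rewrite adj_irr.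
have t_lt (v : T2) s : (s + c v) %% k < k.
  by rewrite ltn_mod (leq_ltn_trans _ (c_lt v)).
have cartP a b : cartesian G1 G2 a b ->
    (exists x u v, [/\ a = (x, u), b = (x, v) & G2 u v]) \/
    (exists x y v, [/\ a = (x, v), b = (y, v) & G1 x y]).
  case: a b => [x u] [y v] /orP[] /= /andP[].
    by move=> /eqP-> Guv; left; exists y, u, v.
  by move=> Gxy /eqP->; right; exists x, y, v.
have h_lt x y v : G1 x y -> l (x, v) (y, v) < n * k.
  by move=> Gxy; rewrite l_h //; have := f_ltG _ _ Gxy;
     have := t_lt v (cl (f [set x; y]) x y); nia.
have cl_sym i x y : cl i x y = cl i y x.
  by rewrite /cl; case: insub => // j; have [_ _ ->] := rcP j.
have cl_lt (i : 'I_n) x y : G1 x y -> f [set x; y] = i -> cl i x y < k.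
  move=> Gxy fi; rewrite clE; have [_ _ _ + _] := rcP i; apply.
  - by have [] := vertsP _ _ _ Gxy fi.
  - by have [] := vertsP _ _ _ Gxy fi.
  - by apply: residualP; rewrite ?fi.
have cl_inj (i : 'I_n) x y z : G1 x y -> G1 x z ->
    f [set x; y] = i -> f [set x; z] = i -> cl i x y = cl i x z -> y = z.
  move=> Gxy Gxz fy fz; rewrite !clE.
  have [_ _ _ _ /(_ x y z)] := rcP i; apply.
  - by have [] := vertsP _ _ _ Gxy fy.
  - by have [] := vertsP _ _ _ Gxy fy.
  - by have [] := vertsP _ _ _ Gxz fz.
  - by apply: residualP; rewrite ?fy.
  - by apply: residualP; rewrite ?fz.
apply/pmd_le/(@pmd_levels_has_pmd _ _ _ _ l); split.
- move=> a b /cartP[[x [u [v [-> -> Guv]]]]|[x [y [v [-> -> Gxy]]]]].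
    by rewrite !l_v l2_sym.
  by rewrite (l_h x y) // (l_h y x) 1?adj_sym // (setUC [set y]) (cl_sym _ y).
- move=> a b /cartP[[x [u [v [-> -> Guv]]]]|[x [y [v [-> -> Gxy]]]]].
    by rewrite l_v addnC ltn_add2r l2_lt.
  exact: leq_trans (h_lt _ _ v Gxy) (leq_addl _ _).
(* Edges of different kinds have levels on different sides of [n * k]. Two [G1] edges at one vertex
   with equal levels share the forest and the shift [c v], hence the colour. *)
- move=> a b d /cartP[[x [u [v [-> -> Guv]]]]|[x [y [v [-> -> Gxy]]]]];
    move=> /cartP[[x' [u' [v' [[<- <-] -> Guv']]]]|
                  [x' [y' [v' [[<- <-] -> Gxy']]]]].
  + by rewrite !l_v => /addnI eq_l; rewrite (l2_inj _ _ _ Guv Guv').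
  + by move=> eq_l; have := h_lt _ _ u Gxy'; rewrite -eq_l l_v ltnNge leq_addr.
  + by move=> eq_l; have := h_lt _ _ v Gxy; rewrite eq_l l_v ltnNge leq_addr.
  + rewrite !l_h // => /mulD_ltn_inj[]; rewrite ?t_lt // => eq_f eq_t.
    have fi : f [set x; y] = Ordinal (f_ltG _ _ Gxy) by [].
    have fi' : f [set x; y'] = Ordinal (f_ltG _ _ Gxy) by rewrite -eq_f.
    congr (_, _); apply: (cl_inj _ _ _ _ Gxy Gxy' fi fi').
    move/eqP: eq_t; rewrite -eq_f eqn_modDr.
    by rewrite !modn_small => [/eqP//||]; rewrite fi cl_lt.
(* From level [n * k] on only copies of [G2] remain, and a weight for [G2] is pulled back along the
   second coordinate. *)
move=> j lt_jp; have [lt_j|le_j] := ltnP j (n * k); last first.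
  have [w wP] := l2_pos (j - n * k) ltac:(lia).
  exists (fun a => w a.2) => a b.
  case/cartP=> [[x [u [v [-> -> Guv]]]]|[x [y [v [-> -> Gxy]]]]] /=.
    rewrite l_v => le_jl; rewrite wP //; last by lia.
    by split=> ?; lia.
  by move=> le_jl; have := h_lt _ _ v Gxy; lia.
have k_gt0 : 0 < k by case: (k) lt_j => //; rewrite muln0.
have lt_i : j %/ k < n by rewrite ltn_divLR.
have lt_t : j %% k < k by rewrite ltn_mod.
pose i := Ordinal lt_i.
have [r1 r2 r3 r4 r5] := rcP i.
pose Fi x y := G1 x y && (f [set x; y] == i).
(* [Hi] may still contain edges of forest [i] removed at earlier steps; the weight has the right
   sign on all of them. *)
pose Hi x y := G1 x y && (i <= f [set x; y]).
have HiP x y : Hi x y -> residual F i x y by case/andP; apply: residualP.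
have FiP x y : Fi x y -> [/\ Hi x y, x \in sg_verts (F i) & y \in sg_verts (F i)].
  move=> /andP[Gxy /eqP fi]; have [Vx Vy] := vertsP _ _ _ Gxy fi.
  by split=> //; rewrite /Hi Gxy fi /=.
have [||//||||||//|//|w [wh wv]] := @forest_step_weight R T1 T2 G2
  (sg_verts (F i)) Hi Fi (rc i).1 (rc i).2 c k (j %% k).
- by move=> x y; rewrite /Hi adj_sym setUC.
- by move=> x y; rewrite /Fi adj_sym setUC.
- by move=> x y Vx Vy /HiP; apply: r1.
- by move=> x y z Vx Vy Vz /HiP Hy /HiP; apply: r2.
- exact: r3.
- by move=> x y /FiP[/HiP Hxy Vx Vy]; apply: r4.
- move=> x y z /FiP[/HiP Hxy Vx Vy] /FiP[/HiP Hxz _ Vz]; exact: r5.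
exists w => a b /cartP[[x [u [v [-> -> Guv]]]]|[x [y [v [-> -> Gxy]]]]].
  (* An edge of a [G2] copy is not removed at a level below [n * k], so its sum must be
     nonpositive. *)
  move=> _; split=> [w_gt0|eq_l]; last first.
    by rewrite -eq_l l_v ltnNge leq_addr in lt_j.
  by move: (wv x _ _ Guv); rewrite leNgt w_gt0.
rewrite l_h // {1 2}(divn_eq j k) => le_jl.
have le_if := mulD_ltn_le lt_t (t_lt _ _) le_jl.
rewrite wh /Fi /Hi ?Gxy //=.
split=> [[/eqP -> <-]|/mulD_ltn_inj[]//]; first by rewrite -clE.
by move=> eq_f eq_t; rewrite eq_f eqxx -clE -eq_t eq_f.
Qed.

Theorem theorem2p8 (R : realType) (T1 T2 : finType)
    (G1 : sgraph T1) (G2 : sgraph T2)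
    (n : nat) (n_ge1 : 1 <= n) (F : 'I_n -> subgraph G1)
    (F_dec : forest_decomposition F)
    (degF : \sum_(i < n) max_degree (residual_induced F i) <= #|T2|) :
  pmd R (cartesian G1 G2) <=
    pmd R G2 + n * maxn (\sum_(i < n) max_degree (residual_induced F i))
                        (chromatic_number G2).
Proof.
(* Each degree is at most the sum of all of them, so the maximum can serve as [k]. *)
apply: (pmd_cartesian_le R F_dec) => [i|]; last exact: leq_maxr.
by apply: leq_trans (leq_maxl _ _); rewrite (bigD1 i) //= leq_addr.
Qed.
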